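(* For any $r\ge3$ and any family $\mathcal{F}$ of $r$-graphs, the function $g(\mathcal{F}):\mathrm{proj}\,\Omega(\mathcal{F})\to[0,1]$ is left-continuous, has at most countably many jump discontinuities, and is almost everywhere differentiable.
   Context: An $r$-graph $\mathcal{H}$ is a finite vertex set $V(\mathcal{H})$ together with a set of $r$-element subsets of it (edges); $|\mathcal{H}|$ is the number of edges and $v(\mathcal{H})=|V(\mathcal{H})|$. The shadow is $\partial\mathcal{H}=\{A\in\binom{V(\mathcal{H})}{r-1}: A\subset B \text{ for some } B\in\mathcal{H}\}$. For a family $\mathcal{F}$ of $r$-graphs, $\mathcal{H}$ is $\mathcal{F}$-free if it contains no member of $\mathcal{F}$ as a (not necessarily induced) subgraph. The edge density is $d(\mathcal{H})=|\mathcal{H}|/\binom{v(\mathcal{H})}{r}$ and the shadow density is $d(\partial\mathcal{H})=|\partial\mathcal{H}|/\binom{v(\mathcal{H})}{r-1}$. A sequence $(\mathcal{H}_k)_{k\ge1}$ of $r$-graphs is good if $v(\mathcal{H}_k)\to\infty$ and both $\lim_k d(\mathcal{H}_k)$ and $\lim_k d(\partial\mathcal{H}_k)$ exist; it realizes $(x,y)\in[0,1]^2$ if $\lim_k d(\partial\mathcal{H}_k)=x$ and $\lim_k d(\mathcal{H}_k)=y$. The feasible region $\Omega(\mathcal{F})$ is the set of all $(x,y)\in[0,1]^2$ realized by some good sequence of $\mathcal{F}$-free $r$-graphs; it is a closed set. $\mathrm{proj}\,\Omega(\mathcal{F})=\{x: \exists y\in[0,1],\ (x,y)\in\Omega(\mathcal{F})\}$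 (an interval of the form $[0,\hat c]$), and for $x\in\mathrm{proj}\,\Omega(\mathcal{F})$, $g(\mathcal{F},x)=g(\mathcal{F})(x)=\max\{y:(x,y)\in\Omega(\mathcal{F})\}$. A jump discontinuity of $f$ at $x$ is a discontinuity at which both one-sided limits exist and are different. *)

(* Defs.v *)
From HB Require Import structures.
From mathcomp Require Import all_boot all_order all_algebra.
From mathcomp Require Import all_classical all_reals all_analysis.

Set Implicit Arguments.
Unset Strict Implicit.
Unset Printing Implicit Defensive.

Import Order.TTheory GRing.Theory Num.Theory.
Import numFieldNormedType.Exports.

Local Open Scope classical_set_scope.
Local Open Scope ring_scope.

Record uhypergraph (r : nat) : Type := UHypergraph {
  vertex : finType;
  edges : {set {set vertex}};
  edges_uniform : forall e : {set vertex}, e \in edges -> #|e| = r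
}.

Definition shadow (r : nat) (H : uhypergraph r) : {set {set vertex H}} :=
  [set A : {set vertex H} |
    (#|A| == r.-1) && [exists B in edges H, A \subset B]]%SET.

(* Not necessarily induced, up to an injective relabelling of vertices. *)
Definition subgraph (r : nat) (G H : uhypergraph r) : Prop :=
  exists f : vertex G -> vertex H,
    injective f /\
    forall e : {set vertex G}, e \in edges G -> (f @: e)%SET \in edges H.

Definition is_free (r : nat) (F : uhypergraph r -> Prop) (H : uhypergraph r) : Prop :=
  forall G, F G -> ~ subgraph G H.

Section FeasibleRegion.
Variables (R : realType) (r : nat).

(* Both densities are 0 when the binomial coefficient vanishes; this is
   irrelevant for limits along sequences with v(H_k) --> oo. *)
Definition density (H : uhypergraph r) : R :=
  #|edges H|%:R / 'C(#|vertex H|, r)%:R.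

Definition shadow_density (H : uhypergraph r) : R :=
  #|shadow H|%:R / 'C(#|vertex H|, r.-1)%:R.

Definition good (H : nat -> uhypergraph r) : Prop :=
  [/\ #|vertex (H k)| @[k --> \oo] --> \oo,
      cvgn (fun k => density (H k)) &
      cvgn (fun k => shadow_density (H k))].

Definition realizes (H : nat -> uhypergraph r) (p : R * R) : Prop :=
  shadow_density (H k) @[k --> \oo] --> p.1 /\
  density (H k) @[k --> \oo] --> p.2.

Definition feasible_region (F : uhypergraph r -> Prop) : set (R * R) :=
  [set p | [/\ 0 <= p.1 <= 1, 0 <= p.2 <= 1 &
     exists H : nat -> uhypergraph r,
       [/\ good H, (forall k, is_free F (H k)) & realizes H p]]].

Definition proj_feasible (F : uhypergraph r -> Prop) : set R :=
  [set x | exists2 y, 0 <= y <= 1 & feasible_region F (x, y)].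

Definition is_max (A : set R) (m : R) : Prop := A m /\ ubound A m.

(* The maximum of the fibre over x, extended by 0 to the x for which the
   fibre has no maximum, in particular to all x outside proj_feasible F. *)
Definition feasible_max (F : uhypergraph r -> Prop) (x : R) : R :=
  xget 0 (is_max [set y | feasible_region F (x, y)]).

End FeasibleRegion.

Section OneSided.
Variables (R : realType) (D : set R) (f : R -> R).

(* All notions are relative to the domain D: only points of D are used in
   limits.  A one-sided limit at x makes sense only if x is an accumulation
   point of D from that side. *)
Definition left_limit (x l : R) : Prop :=
  limit_point (D `&` [set t | t < x]) x /\
  f t @[t --> within D x^'-] --> l.

Definition right_limit (x l : R) : Prop :=
  limit_point (D `&` [set t | x < t]) x /\
  f t @[t --> within D x^'+] --> l.

Definition left_continuous_on : Prop :=
  forall x, D x -> f t @[t --> within D x^'-] --> f x.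

Definition jump_discontinuity (x : R) : Prop :=
  [/\ D x,
      ~ (f t @[t --> within D (nbhs x)] --> f x) &
      exists l1 l2, [/\ left_limit x l1, right_limit x l2 & l1 <> l2]].

End OneSided.

(* Main.v *)
Require Import Defs.
From HB Require Import structures.
From mathcomp Require Import all_boot all_order all_algebra.
From mathcomp Require Import all_classical all_reals all_analysis.
From mathcomp Require Import measurable_realfun ring lra zify.
Import Order.TTheory GRing.Theory Num.Theory.
Import numFieldNormedType.Exports.
Local Open Scope classical_set_scope.
Local Open Scope ring_scope.

(** Write g for the maximal feasible edge density.  Removing from an r-graph
    all the edges through an (r-1)-set of minimum degree in the shadow costs
    at most a fraction r / |shadow| of the edges and O(n) = o(n^(r-1))
    elements of the shadow.  Iterating, one can lower the shadow density from
    y to any x < y while keeping at least a fraction (x / y)^r of the edges,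
    so g x / x^r is nonincreasing on the positive part of the domain, which is
    an interval.  Hence g has countably many jumps and, by Lebesgue's theorem
    on monotone functions, is differentiable almost everywhere.  Left
    continuity combines this monotonicity with the upper semicontinuity of g,
    i.e. the closedness of the feasible region.

    For Lebesgue's theorem, let G = id + f with f nondecreasing.  G expands
    distances, so the image nu under G of Lebesgue measure on ]u, v[ is
    dominated by Lebesgue measure and has a density h.  Its distribution
    function F satisfies F (G x) = x - u and F' = h almost everywhere; since
    nu does not charge the null set where this fails nor [h = 0], for almost
    every x the function F has a nonzero derivative at G x, and G, of which F
    is a left inverse up to a constant, is differentiable at x. *)

(** * Differentiability of monotone functions *)

(** [S] lies in the interval from [inf S] to [inf S + l]. As [S] is arbitrary, monotonicity of the
    outer measure is used. *)
Lemma lebesgue_measure_diameter (R : realType) (S : set R) (l : R) :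
  0 <= l -> (forall x y, S x -> S y -> x - y <= l) ->
  (@lebesgue_measure R S <= l%:E)%E.
Proof.
move=> l0 Sl; have [->|/set0P[s Ss]] := eqVneq S set0.
  by rewrite measure0 lee_fin.
have lbS x : S x -> lbound S (x - l).
  by move=> Sx y Sy; rewrite lerBlDr -lerBlDl Sl.
have hS : has_inf S by split; [exists s|exists (s - l); exact: lbS].
apply: (@le_trans _ _ (lebesgue_measure (`[inf S, inf S + l]%classic : set R))).
  apply: le_outer_measure => x Sx /=; rewrite in_itv/= ge_inf//=; last first.
    by exists (s - l); exact: lbS.
  by rewrite -lerBlDr; apply: lb_le_inf; [exists s|exact: lbS].
rewrite lebesgue_measure_itv/= lte_fin -EFinB.
by case: ifP => // _; rewrite lee_fin// addrAC subrr add0r.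
Qed.

(** The measure is an infimum over covers by half-open intervals. Pulling a cover of [E] back along
    [G] covers the preimage, and expansiveness bounds the diameter of each piece by the length of
    its interval. *)
Lemma lebesgue_measure_preimage_expansive (R : realType) (G : R -> R) (E : set R) :
  (forall x y, x <= y -> y - x <= G y - G x) ->
  (@lebesgue_measure R (G @^-1` E) <= @lebesgue_measure R E)%E.
Proof.
move=> expG; apply: le_ereal_inf_tmp => _ [A [mA EA] <-].
apply: (@le_trans _ _ (lebesgue_measure (\bigcup_k (G @^-1` A k)))).
  by apply: le_outer_measure => x /EA[k _ Ak]; exists k.
apply: (le_trans (outer_measure_sigma_subadditive lebesgue_measure _)).
apply: lee_nneseries => // k _.
have [[a b] _ <-] := mA k => /=.
rewrite wlength_itv/= lte_fin -EFinB; case: ltP => [ab|ba]; last first.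
  have -> : `]a, b]%classic = set0 :> set R by rewrite set_itv_ge// bnd_simp -leNgt.
  by rewrite preimage_set0 outer_measure0.
apply: lebesgue_measure_diameter; first by rewrite subr_ge0 ltW.
move=> x y /=; rewrite !in_itv/= => /andP[ax xb] /andP[ay yb].
have [xy|/ltW yx] := leP x y; first by rewrite (@le_trans _ _ 0) ?subr_le0 ?subr_ge0 ?(ltW ab).
by rewrite (le_trans (expG _ _ yx))// lerB// ltW.
Qed.

(** Radon-Nikodym for the push-forward under [G] of Lebesgue measure on []u, v[]: the restriction
    makes it finite, expansiveness makes it absolutely continuous. *)
Lemma lebesgue_preimage_density (R : realType) (G : R -> R) (u v : R) :
  (forall x y, x <= y -> y - x <= G y - G x) ->
  exists h : R -> R, lebesgue_measure.-integrable setT (EFin \o h) /\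
    forall A : set R, measurable A ->
      (@lebesgue_measure R (G @^-1` A `&` `]u, v[) =
       \int[lebesgue_measure]_(y in A) (h y)%:E)%E.
Proof.
move=> expG.
have mG : measurable_fun [set: measurableTypeR R] (G : _ -> measurableTypeR R).
  apply: nondecreasing_measurable => // x y xy.
  by rewrite -subr_ge0 (le_trans _ (expG _ _ xy))// subr_ge0.
have mD : measurable (`]u, v[%classic : set (measurableTypeR R)) by exact: measurable_itv.
have moo : (@lebesgue_measure R `]u, v[%classic < +oo)%E.
  by rewrite lebesgue_measure_itv/=; case: ifP => _; rewrite ltry.
pose la := charge_of_finite_measure (mfrestr mD moo).
pose nu : {charge set (measurableTypeR R) -> \bar R} :=
  measure_function_pushforward__canonical__charge_Charge la mG.
have nuE A : nu A = lebesgue_measure (G @^-1` A `&` `]u, v[) by [].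
have nu_dom : nu `<< lebesgue_measure.
  move=> N nullN A mA AN; apply/eqP; rewrite nuE eq_le measure_ge0 andbT.
  rewrite -(nullN _ mA AN).
  apply: le_trans (lebesgue_measure_preimage_expansive _ _ A expG).
  by apply: le_outer_measure => x [].
pose h := Radon_Nikodym nu lebesgue_measure.
exists (fine \o h).
have hE : EFin \o (fine \o h) = h.
  by apply/funext => y /=; rewrite fineK// Radon_Nikodym_fin_num.
rewrite hE; split; first exact: Radon_Nikodym_integrable.
move=> A mA; rewrite -nuE (Radon_Nikodym_integral nu_dom mA).
by apply: eq_integral => y _; rewrite -[in RHS]/((EFin \o (fine \o h)) y) hE.
Qed.

(** Carathéodory's form of the derivative writes [F y - F (G x)] as [k y * (y - G x)] with [k]
    continuous and nonzero at [G x]. Hence [F] is strictly increasing at [G x], which forces [G] to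
    be continuous at [x], and the difference quotients of [G] are the inverses of [k (G z)]. *)
Lemma derivable_left_inverse (R : realType) (F G : R -> R) (x : R) :
  {homo F : y z / y <= z} -> (\forall z \near x, F (G z) = z) ->
  derivable F (G x) 1 -> derive1 F (G x) != 0 -> derivable G x 1.
Proof.
move=> ndF FG dF F'0.
have /is_derive1_caratheodory[k [kE ck kGx]] : is_derive (G x) 1 F (derive1 F (G x)).
  by rewrite derive1E; exact/derivableP.
have FGx : F (G x) = x by exact: nbhs_singleton FG.
have k0 : \forall z \near G x, k z != 0 by apply: cvgr_neq0 ck _; rewrite kGx.
have [d /= d0 kd] : \forall e \near 0^'+, forall y, `|G x - y| < e -> k y != 0.
  move/nbhs_ballP : k0 => [d /= d0 kd]; exists d => //= e.
  rewrite /ball_ /= sub0r normrN => + e0 y ye; rewrite gtr0_norm// => ed.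
  by apply: kd; exact: lt_trans ed.
have FD e : e != 0 -> `|e| < d / 2 -> F (G x + e) != F (G x).
  move=> e0 ed; rewrite -subr_eq0 kE addrAC subrr add0r mulf_neq0//.
  apply: (kd (d / 2)) => /=.
  - by rewrite /ball_ /= sub0r normrN gtr0_norm ?divr_gt0// ltr_pdivrMr// ltr_pMr// ltr1n.
  - by rewrite divr_gt0.
  - by rewrite opprD addrA subrr add0r normrN.
have ltF e : 0 < e -> F (G x) < F (G x + e).
  (* The cap [d / 3] keeps the shift below [d / 2], where [FD] applies; monotonicity of [F] carries
     the strict inequality on to [e]. *)
  move=> e0; pose t := Num.min e (d / 3).
  have t0 : 0 < t by rewrite lt_min e0 divr_gt0.
  apply: (@lt_le_trans _ _ (F (G x + t))); last by rewrite ndF// lerD2l ge_min lexx.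
  rewrite lt_neqAle eq_sym FD ?gt_eqF//=; first by rewrite ndF// lerDl ltW.
  rewrite gtr0_norm// gt_min; apply/orP; right; lra.
have gtF e : 0 < e -> F (G x - e) < F (G x).
  move=> e0; pose t := Num.min e (d / 3).
  have t0 : 0 < t by rewrite lt_min e0 divr_gt0.
  apply: (@le_lt_trans _ _ (F (G x - t))); first by rewrite ndF// lerD2l lerN2 ge_min lexx.
  rewrite lt_neqAle FD ?oppr_eq0 ?gt_eqF//=; first by rewrite ndF// gerBl ltW.
  rewrite normrN gtr0_norm// gt_min; apply/orP; right; lra.
(* If [G z] were at most [G x - e], then [z = F (G z)] would be at most [F (G x - e) < x],
   impossible for [z] close to [x]; likewise above. *)
have cG : {for x, continuous G}.
  apply/cvgrPdist_lt => e e0; near=> z.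
  have FGz : F (G z) = z by near: z; exact: FG.
  rewrite ltr_distlC; apply/andP; split; rewrite ltNge; apply/negP => /ndF;
    rewrite FGz; apply/negP; rewrite -ltNge.
  - near: z; apply: lt_nbhsr; rewrite -[ltRHS]FGx; exact: gtF.
  - near: z; apply: lt_nbhsl; rewrite -[ltLHS]FGx; exact: ltF.
apply: (@ex_derive _ _ _ _ _ _ (derive1 F (G x))^-1).
apply/is_derive1_caratheodory.
exists (fun z => if z == x then (derive1 F (G x))^-1 else (G z - G x) / (z - x)).
rewrite eqxx; split => //.
  move=> z; case: eqVneq => [->|zx]; first by rewrite !subrr mulr0.
  by rewrite divfK// subr_eq0.
have : (k (G z))^-1 @[z --> x] --> (derive1 F (G x))^-1.
  by rewrite -kGx; apply: cvgV; [rewrite kGx|exact: (continuous_comp cG ck)].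
rewrite /prop_for /continuous_at eqxx; apply: cvg_trans; apply: near_eq_cvg; near=> z.
have FGz : F (G z) = z by near: z; exact: FG.
case: eqVneq => [->|zx]; first by rewrite kGx.
have := kE (G z); rewrite FGz FGx => ->.
have [Gzx|Gzx] := eqVneq (G z) (G x).
  by move: zx; rewrite -FGz Gzx FGx eqxx.
rewrite invfM mulrCA divff ?mulr1// subr_eq0//.
Unshelve. all: by end_near. Qed.

Lemma expansive_ae_derivable (R : realType) (G : R -> R) (u v : R) :
  (forall x y, x <= y -> y - x <= G y - G x) ->
  {ae (@lebesgue_measure R), forall x, u < x < v -> derivable G x 1}.
Proof.
move=> expG; have [h [inth hE]] := lebesgue_preimage_density _ G u v expG.
pose I (y : R) : R := (\int[lebesgue_measure]_(t in [set` `]-oo, y]]) h t)%R.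
(* The constant [u] makes [F] an exact left inverse: the part of []u, v[] that [G] sends below [G x]
   is []u, x]], of length [x - u]. *)
pose F y := u + I y.
have FE y : F y = u + fine (@lebesgue_measure R (G @^-1` `]-oo, y] `&` `]u, v[)).
  by rewrite /F /I hE.
have mG : measurable_fun [set: measurableTypeR R] (G : _ -> measurableTypeR R).
  apply: nondecreasing_measurable => // x y xy.
  by rewrite -subr_ge0 (le_trans _ (expG _ _ xy))// subr_ge0.
have mGI (A : set (measurableTypeR R)) : measurable A ->
    measurable (G @^-1` A `&` `]u, v[ : set (measurableTypeR R)).
  by move=> mA; apply: measurableI => //; rewrite -[X in measurable X]setTI; exact: mG.
have finG A : measurable A ->
    (@lebesgue_measure R (G @^-1` A `&` `]u, v[) \is a fin_num)%E.
  move=> mA; rewrite hE//; apply: integrable_fin_num => //.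
  exact: integrableS inth.
have ndF : {homo F : y z / y <= z}.
  move=> y z yz; rewrite !FE lerD2l fine_le ?finG//.
  apply: le_outer_measure => x [+ xI]; rewrite /preimage /= !in_itv/= => Gxy.
  by split => //; exact: le_trans Gxy yz.
have FG x : u < x < v -> F (G x) = x.
  move=> /andP[ux xv]; rewrite FE.
  have -> : G @^-1` `]-oo, G x] `&` `]u, v[ = `]u, x]%classic :> set R.
    apply/seteqP; split => z; rewrite /preimage /= !in_itv/=.
      move=> [Gzx /andP[uz zv]]; rewrite uz/= leNgt; apply/negP => xz.
      have := expG _ _ (ltW xz); rewrite leNgt (le_lt_trans _ (_ : 0 < _)) ?subr_gt0//.
      by rewrite subr_le0.
    move=> /andP[uz zx]; rewrite uz (le_lt_trans zx xv); split => //.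
    by rewrite -subr_ge0 (le_trans _ (expG _ _ zx))// subr_ge0.
  by rewrite lebesgue_measure_itv/= lte_fin ux -EFinB/= addrC subrK.
have [N [mN N0 NP]] : {ae (@lebesgue_measure R), forall y,
    derivable F y 1 /\ derive1 F y = h y}.
  have : {ae (@lebesgue_measure R), forall y, derivable I y 1 /\ derive1 I y = h y}.
    apply: FTC1Ny => [y|]; first by apply: integrableS inth.
    by apply: open_integrable_locally inth; exact: openT.
  apply: filterS; first exact: (ae_filter_ringOfSetsType lebesgue_measure).
  move=> y [dI I'].
  have dF : derivable F y 1 by apply: derivableD.
  by split => //; rewrite -I' !derive1E deriveD// derive_cst add0r.
pose Z := [set y | h y = 0].
have mZ : measurable (Z : set (measurableTypeR R)).
  have mh : measurable_fun setT h by apply/measurable_EFinP; exact: measurable_int inth.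
  rewrite -[Z]setTI; exact: (mh measurableT [set 0]).
(* The first set is null because [N] is, by expansiveness; the measure of the second is the integral
   of [h] over its own zero set. *)
exists ((G @^-1` N `&` `]u, v[) `|` (G @^-1` Z `&` `]u, v[)); split.
- by apply: measurableU; exact: mGI.
- apply/eqP; rewrite -measure_le0.
  rewrite (le_trans (measureU2 _ _ _))//; [exact: mGI|exact: mGI|].
  rewrite [X in (_ + X)%E]hE// integral0_eq ?adde0; last by move=> y ->.
  rewrite -N0 (le_trans _ (lebesgue_measure_preimage_expansive _ _ N expG))//.
  by apply: le_outer_measure => x [].
- move=> x /not_implyP[xuv ndG].
  have xI : `]u, v[%classic x by rewrite /= in_itv.
  have [Nx|/contrapT[dF F'h]] := pselect (~ (derivable F (G x) 1 /\ derive1 F (G x) = h (G x))).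
    by left; split => //; exact: NP.
  right; split => //; apply: contrapT => hGx; apply: ndG.
  apply: derivable_left_inverse dF _ => //.
    near=> z; apply: FG; near: z.
    exact: near_in_itvoo.
  by rewrite F'h; apply/eqP.
Unshelve. all: by end_near. Qed.

Lemma nondecreasing_ae_derivable (R : realType) (f : R -> R) (u v : R) :
  {in `[u, v] &, {homo f : x y / x <= y}} ->
  {ae (@lebesgue_measure R), forall x, u < x < v -> derivable f x 1}.
Proof.
move=> ndf; have [vu|uv] := leP v u.
  by apply: aeW => x /andP[ux /(lt_trans ux)]; rewrite ltNge vu.
(* The expansive map must be defined on the whole line: freeze [f] outside
   [u, v]. *)
pose clamp x := Num.max u (Num.min x v).
have clampI x : clamp x \in `[u, v].
  by rewrite in_itv/= le_max lexx/= ge_max ltW//= ge_min lexx orbT.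
pose G x := x + f (clamp x).
have expG x y : x <= y -> y - x <= G y - G x.
  move=> xy; rewrite /G opprD addrACA lerDl subr_ge0 ndf// /clamp.
  by rewrite ge_max le_max lexx/= le_max le_min2 ?orbT.
have := expansive_ae_derivable _ G u v expG; apply: filterS.
  exact: (ae_filter_ringOfSetsType lebesgue_measure).
move=> x + xuv => /(_ xuv) dG.
apply: (@ex_derive _ _ _ _ _ _ (derive G x 1 - derive id x 1)).
apply: (@near_eq_is_derive _ _ _ (G - id)); last first.
  by apply: is_deriveB; apply/derivableP.
have xI : x \in `]u, v[ by rewrite in_itv.
near=> z; have : z \in `]u, v[ by near: z; exact: near_in_itvoo.
rewrite in_itv/= => /andP[uz zv].
rewrite fctE /G /clamp min_l ?max_r ?(ltW uz) ?(ltW zv)// addrC addKr.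
Unshelve. all: by end_near. Qed.

Lemma ae_forall_countable (R : realType) (T : countType) (P : T -> R -> Prop) :
  (forall t, {ae (@lebesgue_measure R), forall x, P t x}) ->
  {ae (@lebesgue_measure R), forall x, forall t, P t x}.
Proof.
move=> aeP.
have : {ae (@lebesgue_measure R), forall x, forall n,
    if unpickle n is Some t then P t x else True}.
  by apply: ae_foralln => n; case: unpickle => [t|]; [exact: aeP|exact: aeW].
apply: filterS; first exact: (ae_filter_ringOfSetsType lebesgue_measure).
by move=> x Px t; have := Px (pickle t); rewrite pickleK.
Qed.

(** * Functions [g] such that [g x / x ^ r] is nonincreasing *)

Lemma near_within_cvg (T : Type) (U : topologicalType) (F : set_system T)
    (FF : Filter F) (D : set T) (f : T -> U) (l : U) :
  (\forall t \near F, D t) -> f t @[t --> within D F] --> l ->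
  f t @[t --> F] --> l.
Proof.
by move=> FD fl V /fl; apply: filterS2 FD => t Dt; apply.
Qed.

(** The sign turns the ratio into a nondecreasing function, as the results on monotone functions
    require; [0 < u] keeps the denominators positive. *)
Lemma scaled_nonincreasing (R : realType) (r : nat) (D : set R) (g : R -> R) (u v : R) :
  (forall x y, D y -> 0 <= x <= y -> D x) ->
  (forall x y, D y -> 0 < x <= y -> g y * x ^+ r <= g x * y ^+ r) ->
  0 < u -> D v -> {in `[u, v] &, {homo (fun x => - (g x / x ^+ r)) : x y / x <= y}}.
Proof.
move=> Ddown gscale u0 Dv x y; rewrite !in_itv/= => /andP[ux xv] /andP[uy yv] xy.
have x0 := lt_le_trans u0 ux; have y0 := lt_le_trans u0 uy.
rewrite lerN2 ler_pdivrMr ?exprn_gt0// mulrAC ler_pdivlMr ?exprn_gt0//.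
by apply: gscale; [apply: Ddown Dv _; rewrite ltW|rewrite x0].
Qed.

(** For [t < x] the scaling inequality gives [g t >= g x * (t / x) ^+ r], which tends to [g x];
    upper semicontinuity gives the matching upper bound. *)
Lemma scaled_left_continuous (R : realType) (r : nat) (D : set R) (g : R -> R) :
  (forall x, D x -> 0 <= x) ->
  (forall x y, D y -> 0 < x <= y -> g y * x ^+ r <= g x * y ^+ r) ->
  (forall x e, D x -> 0 < e -> \forall t \near x, D t -> g t < g x + e) ->
  left_continuous_on D g.
Proof.
move=> D0 gscale gusc x Dx.
apply/cvgrPdist_lt => e e0; rewrite near_withinE.
have [x0|x0] := eqVneq x 0.
  near=> t => /D0; rewrite leNgt; have -> // : t < 0.
  by rewrite -x0; near: t; exact: nbhs_left_lt.
have xp : 0 < x by rewrite lt_neqAle eq_sym x0 D0.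
have hc : g x * (t / x) ^+ r @[t --> x^'-] --> g x.
  have : {for x, continuous (fun t : R => g x * (t / x) ^+ r)}.
    apply: continuousM; first exact: cst_continuous.
    apply: (@continuous_comp _ _ _ (fun t : R => t / x) (fun t : R => t ^+ r)).
      exact: mulrr_continuous.
    exact: exprn_continuous.
  (* At [t = x] the factor [(t / x) ^+ r] equals 1. *)
  by move/cvg_at_left_filter; rewrite divff// expr1n mulr1.
near=> t => Dt; rewrite ltr_distlC; apply/andP; split; last first.
  have : D t -> g t < g x + e by near: t; apply: cvg_within; exact: gusc.
  exact.
have t0 : 0 < t by near: t; exact: nbhs_left_gt.
have tx : t < x by near: t; exact: nbhs_left_lt.
apply: (@lt_le_trans _ _ (g x * (t / x) ^+ r)).
  by near: t; apply: (cvgr_gt _ hc); rewrite ltrBlDr ltrDl.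
rewrite expr_div_n mulrA ler_pdivrMr ?exprn_gt0//.
by apply: gscale => //; rewrite t0 ltW.
Unshelve. all: by end_near. Qed.

(** Apart from 0 and [sup D], each point of [D] lies in an interval with rational endpoints [p > 0]
    and [q] in [D], on which the monotone [h] is differentiable almost everywhere. There are
    countably many such intervals, and [g] is recovered as [- (x ^+ r * h x)]. *)
Lemma scaled_ae_derivable (R : realType) (r : nat) (D : set R) (g : R -> R) :
  (forall x, D x -> 0 <= x) ->
  (forall x y, D y -> 0 <= x <= y -> D x) ->
  (forall x y, D y -> 0 < x <= y -> g y * x ^+ r <= g x * y ^+ r) ->
  {ae (@lebesgue_measure R), forall x, D x -> derivable g x 1}.
Proof.
move=> D0 Ddown gscale.
pose h x := - (g x / x ^+ r).
have /ae_forall_countable aeh : forall pq : rat * rat, {ae (@lebesgue_measure R), forall x,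
    0 < (ratr pq.1 : R) -> D (ratr pq.2) -> ratr pq.1 < x < ratr pq.2 ->
    derivable h x 1}.
  move=> [p q] /=; have [[p0 Dq]|npq] := pselect (0 < (ratr p : R) /\ D (ratr q)).
    have := nondecreasing_ae_derivable _ _ _ _
      (scaled_nonincreasing _ r _ g _ _ Ddown gscale p0 Dq).
    by apply: filterS => [|x dx _ _]; first exact: (ae_filter_ringOfSetsType lebesgue_measure).
  by apply: aeW => x p0 Dq; case: npq.
have aeneq (a : R) : {ae (@lebesgue_measure R), forall x, x != a}.
  exists [set a]; split => //; first exact: lebesgue_measure_set1.
  by move=> x /= /negP/negPn/eqP.
have := aeneq 0; have := aeneq (sup D).
move: aeh; apply: filterS3; first exact: (ae_filter_ringOfSetsType lebesgue_measure).
move=> x hx xsup xn0 Dx.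
have x0 : 0 < x by rewrite lt_neqAle eq_sym xn0 D0.
have [y Dy xy] : exists2 y, D y & x < y.
  apply: contrapT => noy; move/eqP: xsup; apply; apply/eqP; rewrite eq_le.
  have ubx : ubound D x.
    by move=> y Dy; rewrite leNgt; apply/negP => xy; apply: noy; exists y.
  by rewrite ub_le_sup//=; [apply: ge_sup => //; exists x|exists x].
have [p /itvP px] := rat_in_itvoo x0.
have [q /itvP qx] := rat_in_itvoo xy.
have Dq : D (ratr q) by apply: Ddown Dy _; rewrite qx (le_trans (ltW x0)) ?qx.
have dh : derivable h x 1 by apply: (hx (p, q)) => //=; rewrite ?px ?qx.
apply: (@ex_derive _ _ _ _ _ _ (derive (- (fun x => x ^+ r * h x)) x 1)).
apply: (@near_eq_is_derive _ _ _ (- (fun x => x ^+ r * h x))); last first.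
  by apply/derivableP/derivableN/derivableM => //; exact: exprn_derivable.
near=> z; have z0 : 0 < z by near: z; exact: lt_nbhsr.
by rewrite fctE /h mulrN opprK mulrCA divff ?mulr1// expf_neq0// gt_eqF.
Unshelve. all: by end_near. Qed.

(** Both one-sided limits of [g] are required at a jump, so [D] has points on either side of it and
    the jump is positive and interior. There it is also a discontinuity of the monotone [h] on some
    rational interval, and each interval carries countably many of these. *)
Lemma scaled_countable_jumps (R : realType) (r : nat) (D : set R) (g : R -> R) :
  (forall x, D x -> 0 <= x) ->
  (forall x y, D y -> 0 <= x <= y -> D x) ->
  (forall x y, D y -> 0 < x <= y -> g y * x ^+ r <= g x * y ^+ r) ->
  countable [set x | jump_discontinuity D g x].
Proof.
move=> D0 Ddown gscale.
pose h x := - (g x / x ^+ r).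
pose J (pq : rat * rat) : set R :=
  [set x | [/\ 0 < (ratr pq.1 : R), D (ratr pq.2),
               x \in `]ratr pq.1, ratr pq.2[ & discontinuity h x]].
apply: (@sub_countable _ _ _ (\bigcup_pq J pq)).
  apply: subset_card_le => x [Dx _ [l1 [l2 [[+ gl] [+ gr] l12]]]].
  move=> /(_ setT filterT)[t [_ [Dt /= tx] _]] /(_ setT filterT)[y [_ [Dy /= xy] _]].
  have x0 : 0 < x by exact: le_lt_trans (D0 _ Dt) tx.
  have [p /itvP px] := rat_in_itvoo x0.
  have [q /itvP qx] := rat_in_itvoo xy.
  have Dq : D (ratr q) by apply: Ddown Dy _; rewrite qx (le_trans (ltW x0)) ?qx.
  have nearD : \forall t \near x, D t.
    near=> z; apply: Ddown Dy _; apply/andP; split; near: z.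
    - by near=> z; apply: ltW; near: z; exact: lt_nbhsr.
    - by near=> z; apply: ltW; near: z; exact: lt_nbhsl.
  have hcvg (F : set_system R) (FF : ProperFilter F) (l : R) :
      F `=>` nbhs x -> (\forall t \near F, D t) ->
      g t @[t --> within D F] --> l -> h t @[t --> F] --> - (l / x ^+ r).
    move=> Fx FD gDl; have Fl : g t @[t --> F] --> l by exact: near_within_cvg FD gDl.
    apply: cvgN; apply: cvgM => //; apply: cvgV; first by rewrite expf_neq0// gt_eqF.
    by apply: cvg_trans (@exprn_continuous _ r x); exact: cvg_app.
  have hl : h t @[t --> x^'-] --> - (l1 / x ^+ r).
    by apply: hcvg; [exact: cvg_within|apply: cvg_within; exact: nearD|].
  have hr : h t @[t --> x^'+] --> - (l2 / x ^+ r).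
    by apply: hcvg; [exact: cvg_within|apply: cvg_within; exact: nearD|].
  exists (p, q) => //; split => //=; rewrite ?px ?in_itv/= ?px ?qx//.
  split; [by apply/cvg_ex; eexists; exact: hl|by apply/cvg_ex; eexists; exact: hr|].
  rewrite (cvg_lim _ hl)// (cvg_lim _ hr)// eqr_opp.
  by apply/eqP => /divIf eql; apply/l12/eql; rewrite expf_neq0// gt_eqF.
apply: bigcup_countable => // -[p q] _.
have [[p0 Dq]|npq] := pselect (0 < (ratr p : R) /\ D (ratr q)); last first.
  rewrite (_ : J _ = set0) //; apply/seteqP; split => // x [/= p0 Dq].
  by case: npq.
have := discontinuity_countable (scaled_nonincreasing _ r _ g _ _ Ddown gscale p0 Dq).
by apply: sub_countable; apply: subset_card_le => x [].
Unshelve. all: by end_near. Qed.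

(** * Truncating the shadow of a hypergraph *)

Lemma card_edges (r : nat) (H : uhypergraph r) : (#|edges H| <= 'C(#|vertex H|, r))%N.
Proof.
rewrite -card_draws; apply/subset_leq_card/fintype.subsetP => e eH.
by rewrite inE (edges_uniform eH).
Qed.

Lemma card_shadow (r : nat) (H : uhypergraph r) :
  (#|shadow H| <= 'C(#|vertex H|, r.-1))%N.
Proof.
rewrite -card_draws; apply/subset_leq_card/fintype.subsetP => A.
by rewrite !inE => /andP[].
Qed.

Lemma subset_cardS (T : finType) (A B : {set T}) :
  A \subset B -> #|B| = #|A|.+1 -> exists2 v, v \in B & A = (B :\ v)%SET.
Proof.
move=> AB cB; have : #|(B :\: A)%SET| == 1%N by rewrite cardsDS// cB subSnn.
move=> /cards1P[v vE]; exists v.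
  by have : v \in (B :\: A)%SET by [rewrite vE set11]; rewrite inE => /andP[].
by rewrite -vE finset.setDDr finset.setDv finset.set0U; apply/esym/finset.setIidPr.
Qed.

Lemma setD1_in_shadow (r : nat) (H : uhypergraph r) (B : {set vertex H}) (v : vertex H) :
  B \in edges H -> v \in B -> (B :\ v)%SET \in shadow H.
Proof.
move=> BH vB; have := edges_uniform BH; rewrite (cardsD1 v B) vB add1n => /(congr1 predn)/= cB.
rewrite inE cB eqxx.
by apply/existsP; exists B; rewrite BH subD1set.
Qed.

Definition degree {r : nat} (H : uhypergraph r) (A : {set vertex H}) : nat :=
  #|[set B in edges H | A \subset B]%SET|.

(** Double counting of the pairs [A \subset B]: an edge [B] contains exactly the [r] shadow sets
    [B :\ v]. *)
Lemma sum_degree (r : nat) (H : uhypergraph r) : (0 < r)%N ->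
  (\sum_(A in shadow H) degree H A = r * #|edges H|)%N.
Proof.
move=> r0; rewrite /degree.
under eq_bigr => A _ do rewrite -sum1_card.
under eq_bigr => A _ do (under eq_bigl => B do rewrite inE).
rewrite (exchange_big_dep (fun B => B \in edges H))/=; last first.
  by move=> A B _ /andP[].
rewrite mulnC -sum_nat_const; apply: eq_bigr => B BH.
rewrite sum1_card -[RHS](edges_uniform BH).
rewrite -(@card_in_imset _ _ (fun v => B :\ v)%SET B); last first.
  move=> v w vB wB /setP/(_ v); rewrite !inE eqxx vB /=.
  by rewrite andbT => /esym/negbT/negPn/eqP.
apply: eq_card => A; apply/idP/imsetP => [|[v vB ->]].
  rewrite unfold_in => /andP[+ /andP[_ AB]].
  rewrite inE => /andP[/eqP cA _].
  have [|v vB ->] := subset_cardS _ _ _ AB; last by exists v.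
  by rewrite cA (edges_uniform BH) prednK.
by rewrite unfold_in /= setD1_in_shadow// BH subD1set.
Qed.

Lemma degree_le (r : nat) (H : uhypergraph r) (A : {set vertex H}) : (0 < r)%N ->
  A \in shadow H -> (degree H A <= #|vertex H|)%N.
Proof.
move=> r0; rewrite inE => /andP[/eqP cA _].
apply: (leq_trans _ (leq_imset_card (fun v => v |: A)%SET (vertex H))).
apply/subset_leq_card/fintype.subsetP => B; rewrite inE => /andP[BH AB].
have [|v vB AE] := subset_cardS _ _ _ AB.
  by rewrite cA (edges_uniform BH) prednK.
by apply/imsetP; exists v => //; rewrite AE finset.setD1K.
Qed.

Lemma subgraph_refl (r : nat) (H : uhypergraph r) : subgraph H H.
Proof. by exists id; split => // e; rewrite imset_id. Qed.

Lemma subgraph_trans (r : nat) (G H K : uhypergraph r) :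
  subgraph G H -> subgraph H K -> subgraph G K.
Proof.
move=> [f [finj fE]] [g [ginj gE]]; exists (g \o f); split; first exact: inj_comp.
by move=> e /fE/gE; rewrite -imset_comp.
Qed.

(** [H1] drops the edges containing [A], so [A] leaves the shadow. Every shadow set that is lost
    lies in a dropped edge, and each of these has only [r] candidates. *)
Lemma delete_shadow_set (r : nat) (H : uhypergraph r) (A : {set vertex H}) : (0 < r)%N ->
  A \in shadow H ->
  exists H1 : uhypergraph r,
    [/\ subgraph H1 H, #|vertex H1| = #|vertex H|,
        #|edges H| = (#|edges H1| + degree H A)%N,
        (#|shadow H1| < #|shadow H|)%N &
        (#|shadow H| <= #|shadow H1| + degree H A * r)%N].
Proof.
move=> r0 AH.
pose E1 := [set B in edges H | ~~ (A \subset B)]%SET.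
pose DA := [set B in edges H | A \subset B]%SET.
have E1u e : e \in E1 -> #|e| = r.
  by rewrite inE => /andP[eH _]; exact: edges_uniform.
pose H1 := UHypergraph E1u.
have sub1 : shadow H1 \subset shadow H.
  apply/fintype.subsetP => B; rewrite !inE => /andP[-> /existsP[C]].
  rewrite inE => /andP[/andP[CH _] BC].
  by apply/existsP; exists C; rewrite CH.
have nA : A \notin shadow H1.
  rewrite inE; apply/negP => /andP[_ /existsP[C]].
  by rewrite inE => /andP[/andP[_ /negP]].
exists H1; split => //.
- exists id; split => // e; rewrite imset_id.
  by rewrite inE => /andP[].
- rewrite addnC -(cardsID [set B : {set vertex H} | A \subset B]%SET (edges H)).
  rewrite /degree; apply: congr2; apply: eq_card => B; rewrite !inE//.
  by rewrite andbC.
- by apply/proper_card/properP; split => //; exists A.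
have sub2 : shadow H \subset
    (shadow H1 :|: \bigcup_(B in DA) [set B :\ v | v in B])%SET.
  apply/fintype.subsetP => B BH; rewrite finset.in_setU -implyNb; apply/implyP => nB.
  have := BH; rewrite inE => /andP[/eqP cB /existsP[C /andP[CH BC]]].
  have [|v vC BE] := subset_cardS _ _ _ BC.
    by rewrite cB (edges_uniform CH) prednK.
  apply/finset.bigcupP; exists C; last by apply/imsetP; exists v.
  rewrite inE CH /=; apply: contraR nB => AC.
  rewrite BE; apply: (setD1_in_shadow _ H1) => //.
  by rewrite inE CH.
apply: (leq_trans (subset_leq_card sub2)).
apply: (leq_trans (leq_card_setU _ _)); rewrite leq_add2l /degree -/DA.
rewrite -sum_nat_const; elim/big_rec2: _ => [|B k S BDA cS]; first by rewrite cards0.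
apply: (leq_trans (leq_card_setU _ _)); rewrite leq_add//.
move: BDA; rewrite inE => /andP[BH _].
by rewrite -[X in (_ <= X)%N](edges_uniform BH) leq_imset_card.
Qed.

(** The minimum degree is at most the average. *)
Lemma min_degree (r : nat) (H : uhypergraph r) : (0 < r)%N -> (0 < #|shadow H|)%N ->
  exists2 A, A \in shadow H & (degree H A * #|shadow H| <= r * #|edges H|)%N.
Proof.
move=> r0 /card_gt0P[A0 A0H].
have [A AH minA] := arg_minnP (degree H) A0H; exists A => //.
by rewrite -sum_degree// mulnC -sum_nat_const; exact: leq_sum.
Qed.

Lemma leq_ffactl (a b k : nat) : (a <= b)%N -> (a ^_ k <= b ^_ k)%N.
Proof.
elim: k a b => [|k IH] [|a] [|b] //; rewrite ?ffact0n// !ffactSS => ab.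
by rewrite leq_mul// IH.
Qed.

Lemma ffact_le_expn (a k : nat) : (a ^_ k <= a ^ k)%N.
Proof. by elim: k => // k IH; rewrite ffactnSr expnSr leq_mul// leq_subr. Qed.

Lemma expn_le_ffact (a k : nat) : (a ^ k <= (a + k) ^_ k)%N.
Proof.
elim: k => // k IH; rewrite addnS ffactSS expnS leq_mul//.
by rewrite -addnS leq_addr.
Qed.

(* Falling factorials are what makes the iteration exact: one deletion keeps a
   fraction (s - r) / s = (s - 1) ^_ r / s ^_ r of the edges, s being the size of
   the shadow, and these fractions telescope. *)
Lemma shadow_truncation_ffact (r : nat) (H : uhypergraph r) (T : nat) : (0 < r)%N ->
  (T <= #|shadow H|)%N ->
  exists H' : uhypergraph r,
    [/\ subgraph H' H, #|vertex H'| = #|vertex H|,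
        (T <= #|shadow H'| <= T + #|vertex H| * r)%N,
        (#|shadow H'| <= #|shadow H|)%N &
        (#|edges H| * #|shadow H'| ^_ r <= #|edges H'| * #|shadow H| ^_ r)%N].
Proof.
(* Induction on the size of the shadow. Above [T + n * r], with [n] vertices, one more deletion is
   safe: it loses at most [n * r] shadow sets, hence does not go below [T]. *)
move=> r0; have [n] := ubnP #|shadow H|; elim: n H => // n IH H sn Ts.
have [sT|Tbig] := leqP #|shadow H| (T + #|vertex H| * r).
  by exists H; split => //; [exact: subgraph_refl|rewrite Ts].
have s0 : (0 < #|shadow H|)%N by exact: leq_ltn_trans Tbig.
have [A AH degA] := min_degree _ _ r0 s0.
have [H1 [sub1 v1 e1 s1 ss1]] := delete_shadow_set _ _ _ r0 AH.
have Ts1 : (T <= #|shadow H1|)%N.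
  rewrite -(leq_add2r (#|vertex H| * r)) (leq_trans (ltnW Tbig))//.
  by rewrite (leq_trans ss1)// leq_add2l leq_mul2r degree_le ?orbT.
have [|H' [sub' v' T' s' e']] := IH H1 _ Ts1; first exact: leq_trans s1 _.
have step : (#|edges H| * #|shadow H1| ^_ r <= #|edges H1| * #|shadow H| ^_ r)%N.
  have m1 : (#|edges H| * (#|shadow H| - r) <= #|edges H1| * #|shadow H|)%N.
    rewrite mulnBr leq_subLR {1}e1 mulnDl addnC leq_add2r.
    by rewrite (leq_trans degA)// mulnC.
  rewrite -(leq_pmul2r s0).
  (* With [s] the size of the shadow, [s * (s - 1) ^_ r] and [s ^_ r * (s - r)] both equal
     [s ^_ r.+1], and the new shadow has at most [s - 1] elements. *)
  apply: (@leq_trans (#|edges H| * ((#|shadow H| - r) * #|shadow H| ^_ r))).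
    rewrite -mulnA leq_mul2l; apply/orP; right.
    rewrite [leqRHS]mulnC -ffactnSr.
    by rewrite -{1 2}(prednK s0) ffactSS mulnC leq_mul// leq_ffactl// -ltnS prednK.
  by rewrite mulnA [leqRHS]mulnAC leq_mul2r m1 orbT.
exists H'; split.
- exact: subgraph_trans sub' sub1.
- by rewrite v'.
- by rewrite -v1.
- exact: leq_trans s' (ltnW s1).
(* The two inequalities are chained by cancelling the number of edges of [H1]. If it is 0, [step]
   makes its left side vanish, and the bound [s'] on the new shadow transfers this to [H']. *)
have [m10|m10] := posnP #|edges H1|.
  apply: (leq_trans (leq_mul (leqnn _) (leq_ffactl _ _ r s'))).
  by rewrite (leq_trans step)// m10 mul0n.
rewrite -(leq_pmul2l m10) mulnCA (leq_trans (leq_mul (leqnn _) e'))//.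
by rewrite mulnCA [leqRHS]mulnCA leq_mul2l step orbT.
Qed.

(** The target is shifted by [r] because [t ^ r <= (t + r) ^_ r], which turns falling factorials
    into powers. *)
Lemma shadow_truncation (r : nat) (H : uhypergraph r) (t : nat) : (0 < r)%N ->
  (t + r <= #|shadow H|)%N ->
  exists H' : uhypergraph r,
    [/\ subgraph H' H, #|vertex H'| = #|vertex H|,
        (t <= #|shadow H'| <= t + r + #|vertex H| * r)%N &
        (#|edges H| * t ^ r <= #|edges H'| * #|shadow H| ^ r)%N].
Proof.
move=> r0 /(shadow_truncation_ffact _ _ _ r0)[H' [subH vH /andP[t1 t2] _ eH]].
exists H'; split => //.
  by rewrite t2 andbT (leq_trans _ t1)// leq_addr.
apply: leq_trans (leq_mul (leqnn _) (ffact_le_expn _ _)).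
apply: leq_trans eH; rewrite leq_mul2l; apply/orP; right.
exact: leq_trans (expn_le_ffact _ _) (leq_ffactl _ _ r t1).
Qed.

(** * The feasible region *)

(* By compactness, [x] is in the projection of the feasible region iff this
   holds for [t = 0], and [g x] is then the largest such [t]. *)
Definition realizable_above (R : realType) {r : nat} (F : uhypergraph r -> Prop)
    (x t : R) : Prop :=
  forall (e : R) (N : nat), 0 < e -> exists H : uhypergraph r,
    [/\ is_free F H, (N <= #|vertex H|)%N, `|shadow_density R H - x| < e &
        t - e < density R H].

Lemma is_free_subgraph (r : nat) (F : uhypergraph r -> Prop) (G H : uhypergraph r) :
  subgraph G H -> is_free F H -> is_free F G.
Proof. by move=> GH freeH K FK KG; apply: (freeH K FK); exact: subgraph_trans GH. Qed.

Lemma density_itv (R : realType) (r : nat) (H : uhypergraph r) :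
  0 <= density R H <= 1.
Proof.
rewrite /density divr_ge0//=.
have [C0|C0] := posnP 'C(#|vertex H|, r); first by rewrite C0 invr0 mulr0.
by rewrite ler_pdivrMr ?ltr0n// mul1r ler_nat card_edges.
Qed.

Lemma shadow_density_itv (R : realType) (r : nat) (H : uhypergraph r) :
  0 <= shadow_density R H <= 1.
Proof.
rewrite /shadow_density divr_ge0//=.
have [C0|C0] := posnP 'C(#|vertex H|, r.-1); first by rewrite C0 invr0 mulr0.
by rewrite ler_pdivrMr ?ltr0n// mul1r ler_nat card_shadow.
Qed.

Lemma realizable_above_itv (R : realType) (r : nat) (F : uhypergraph r -> Prop) (x t : R) :
  realizable_above R F x t -> 0 <= x <= 1 /\ t <= 1.
Proof.
move=> Fxt; split; last first.
  rewrite leNgt; apply/negP => t1.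
  have [|H [_ _ _]] := Fxt (t - 1) 0%N; first by rewrite subr_gt0.
  by have /andP[_ d1] := density_itv R _ H; rewrite subKr ltNge d1.
apply/andP; split; rewrite leNgt; apply/negP => x01.
  have [|H [_ _ + _]] := Fxt (- x) 0%N; first by rewrite oppr_gt0.
  have /andP[s0 _] := shadow_density_itv R _ H.
  by rewrite ltr_norml opprK => /andP[_]; rewrite ltrBlDr addNr ltNge s0.
have [|H [_ _ + _]] := Fxt (x - 1) 0%N; first by rewrite subr_gt0.
have /andP[_ s1] := shadow_density_itv R _ H.
by rewrite ltr_norml => /andP[+ _]; rewrite opprB ltrBrDr subrK ltNge s1.
Qed.

Lemma feasible_realizable_above (R : realType) (r : nat) (F : uhypergraph r -> Prop) (x y : R) :
  feasible_region F (x, y) -> realizable_above R F x y.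
Proof.
move=> [_ _ [H [[Hoo _ _] freeH [/= Hx Hy]]]] e N e0.
have : \forall k \near \oo, [/\ is_free F (H k), (N <= #|vertex (H k)|)%N,
    `|shadow_density R (H k) - x| < e & y - e < density R (H k)].
  near=> k; split => //.
  - near: k; exact: (Hoo _ (nbhs_infty_ge N)).
  - by near: k; exact: cvgr_distC_lt e0.
  - by near: k; apply: (cvgr_gt _ Hy); rewrite ltrBlDr ltrDl.
by move=> [k _ /(_ k (leqnn k)) Pk]; exists (H k).
Unshelve. all: by end_near. Qed.

Lemma realizable_above_seq (R : realType) (r : nat) (F : uhypergraph r -> Prop) (x t : R) :
  realizable_above R F x t -> exists H : nat -> uhypergraph r,
    [/\ forall k, is_free F (H k), #|vertex (H k)| @[k --> \oo] --> \oo,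
        shadow_density R (H k) @[k --> \oo] --> x &
        forall k, t - k.+1%:R^-1 < density R (H k)].
Proof.
move=> Fxt; have /choice[H HP] : forall k, exists H : uhypergraph r,
    [/\ is_free F H, (k <= #|vertex H|)%N, `|shadow_density R H - x| < k.+1%:R^-1 &
        t - k.+1%:R^-1 < density R H].
  by move=> k; apply: Fxt; rewrite invr_gt0.
exists H; split => [k||| k]; [by case: (HP k)| | |by case: (HP k)].
  move=> A [N _ NA]; exists N => // k /= Nk; apply: NA => /=.
  by case: (HP k) => _ kv _ _; exact: leq_trans kv.
apply/cvgrPdist_lt => e e0; near=> k; rewrite distrC.
have [_ _ + _] := HP k; move/lt_trans; apply.
by near: k; exact: near_infty_natSinv_lt (PosNum e0).
Unshelve. all: by end_near. Qed.

(** The supremum of the realizable values is itself realizable, by halving [e]. Along a sequence for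
    it the densities converge, since exceeding it by a fixed amount infinitely often would make a
    larger value realizable. *)
Lemma realizable_above_max (R : realType) (r : nat) (F : uhypergraph r -> Prop) (x : R) :
  realizable_above R F x 0 -> exists m : R,
    [/\ feasible_region F (x, m), realizable_above R F x m &
        forall t, realizable_above R F x t -> t <= m].
Proof.
move=> Fx0; pose A := [set t | realizable_above R F x t].
have ubA : has_ubound A by exists 1 => t /realizable_above_itv[].
have supA : has_sup A by split => //; exists 0.
have Am : realizable_above R F x (sup A).
  move=> e N e0; have e20 : 0 < e / 2 by rewrite divr_gt0.
  have [t At tsup] := sup_adherent e20 supA.
  have [H [freeH vH sH dH]] := At _ N e20; exists H; split => //; first by lra.
  by lra.
have maxA t : A t -> t <= sup A by move=> At; exact: ub_le_sup.
exists (sup A); split => //.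
have [H [freeH Hoo Hx Ht]] := realizable_above_seq _ _ _ _ _ Am.
have Hm : density R (H k) @[k --> \oo] --> sup A.
  apply/cvgrPdist_lt => e e0.
  have : ~ realizable_above R F x (sup A + e).
    by move/maxA; rewrite leNgt ltrDl e0.
  move/existsNP => [e1] /existsNP[N1] /not_implyP[e10 nH1].
  near=> k; rewrite ltr_distlC; apply/andP; split.
    apply: le_lt_trans (Ht k); rewrite lerD2l lerN2 ltW//.
    by near: k; exact: near_infty_natSinv_lt (PosNum e0).
  rewrite ltNge; apply/negP => mk; apply: nH1; exists (H k); split => //.
  - near: k; exact: (Hoo _ (nbhs_infty_ge N1)).
  - by near: k; exact: cvgr_distC_lt e10.
  - by rewrite (lt_le_trans _ mk)// ltrBlDr ltrDl.
have [x01 m1] := realizable_above_itv _ _ _ _ _ Am.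
split => //=; first by rewrite maxA.
exists H; split => //; split => //.
  by apply/cvg_ex; exists (sup A).
by apply/cvg_ex; exists x.
Unshelve. all: by end_near. Qed.

Lemma proj_feasibleP (R : realType) (r : nat) (F : uhypergraph r -> Prop) (x : R) :
  proj_feasible F x <-> realizable_above R F x 0.
Proof.
split=> [[y /andP[y0 _] /feasible_realizable_above Fxy] e N e0|Fx0].
  have [H [? ? ? dH]] := Fxy e N e0; exists H; split => //.
  by apply: le_lt_trans dH; rewrite lerD2r.
by have [m [fm _ _]] := realizable_above_max _ _ _ _ Fx0; exists m => //; case: fm.
Qed.

Lemma feasible_max_spec (R : realType) (r : nat) (F : uhypergraph r -> Prop) (x : R) :
  proj_feasible F x ->
  realizable_above R F x (feasible_max F x) /\
  forall t, realizable_above R F x t -> t <= feasible_max F x.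
Proof.
move=> /proj_feasibleP Fx0.
have [m [fm Fxm maxm]] := realizable_above_max _ _ _ _ Fx0.
suff -> : feasible_max F x = m by [].
apply: xget_unique.
  by split => // z /feasible_realizable_above/maxm.
move=> z [fz ubz]; apply/eqP; rewrite eq_le ubz// andbT.
by apply: maxm; exact: feasible_realizable_above.
Qed.

(** * Lowering the shadow density of a realizable point *)

Lemma leq_subn_bin (m k : nat) : (0 < k)%N -> (m - k <= 'C(m, k))%N.
Proof.
elim: m k => [|m IH] [|[|k]] // _; first by rewrite bin1 leq_subr.
by rewrite subSS binS (leq_trans (IH k.+1 _))// leq_addl.
Qed.

(** The left side is the overshoot allowed in a truncation. It is negligible because the binomial
    coefficient grows at least quadratically when [r] is at least 3. *)
Lemma linear_lt_bin (R : realType) (r : nat) (e : R) : (3 <= r)%N -> 0 < e ->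
  \forall n \near \oo, r%:R + n%:R * r%:R < e * 'C(n, r.-1)%:R.
Proof.
case: r => [|[|[|r]]] // _ e0; near=> n.
have n0 : (0 < n)%N by near: n; exact: nbhs_infty_gt.
have binE : (r.+2 * 'C(n, r.+2) >= n * (n.-1 - r.+1))%N.
  by rewrite -mul_bin_diag leq_mul// leq_subn_bin.
have nbig : 2 * r.+3%:R ^+ 2 < e * (n.-1 - r.+1)%:R :> R.
  rewrite [ltRHS]mulrC -ltr_pdivrMr//.
  near: n; exists (r.+2 + (Num.bound (2 * r.+3%:R ^+ 2 / e)))%N => // n /= nb.
  have q0 : 0 <= 2 * r.+3%:R ^+ 2 / e by rewrite divr_ge0// ltW.
  apply: (lt_le_trans (archi_boundP q0)); rewrite ler_nat. lia.
have rp : 0 < r.+3%:R :> R by [].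
rewrite -(ltr_pM2r rp).
apply: (@le_lt_trans _ _ (n%:R * (2 * r.+3%:R ^+ 2))).
  have n1 : 1 <= n%:R :> R by rewrite ler1n.
  rewrite -subr_ge0 (_ : _ - _ = r.+3%:R ^+ 2 * (n%:R - 1)); last by ring.
  by rewrite mulr_ge0 ?sqr_ge0// subr_ge0.
apply: (@lt_le_trans _ _ (n%:R * (e * (n.-1 - r.+1)%:R))).
  by rewrite ltr_pM2l ?ltr0n.
rewrite mulrCA -mulrA ler_pM2l// -!natrM ler_nat (leq_trans binE)//= mulnC leq_mul//.
Unshelve. all: by end_near. Qed.

(** The members of a sequence for [(x, t)] are truncated to about [x' * M k] shadow sets, [M k]
    being the number of all [(r-1)]-sets. The factor by which the edges shrink tends to at least
    [(x' / x) ^+ r]. *)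
Lemma realizable_above_descent (R : realType) (r : nat) (F : uhypergraph r -> Prop)
    (x x' t : R) : (3 <= r)%N -> 0 <= t -> 0 <= x' < x ->
  realizable_above R F x t -> realizable_above R F x' (t * (x' / x) ^+ r).
Proof.
move=> r3 t0 /andP[x'0 x'x] Fxt e N e0.
have r0 : (0 < r)%N by exact: leq_trans r3.
have x0 : 0 < x by exact: le_lt_trans x'x.
have [H [freeH Hoo Hx Ht]] := realizable_above_seq _ _ _ _ _ Fxt.
pose M k : R := 'C(#|vertex (H k)|, r.-1)%:R.
pose T k := Num.truncn (x' * M k).
pose tau k : R := (T k)%:R / M k.
have linM d : 0 < d ->
    \forall k \near \oo, r%:R + #|vertex (H k)|%:R * r%:R < d * M k.
  by move=> d0; exact: (Hoo _ (linear_lt_bin _ _ _ r3 d0)).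
have Mgt0 : \forall k \near \oo, 0 < M k.
  near=> k; have : r%:R + #|vertex (H k)|%:R * r%:R < 1 * M k.
    by near: k; exact: linM.
  by rewrite mul1r; apply: le_lt_trans; rewrite addr_ge0// mulr_ge0.
have TM k : (T k)%:R <= x' * M k < (T k).+1%:R.
  by apply: truncn_itv; rewrite mulr_ge0.
have tau_cvg : tau k @[k --> \oo] --> x'.
  apply/cvgrPdist_lt => d d0; near=> k.
  have Mk : 0 < M k by near: k.
  have lk : r%:R + #|vertex (H k)|%:R * r%:R < d * M k by near: k; exact: linM.
  have /andP[T1 T2] := TM k.
  have r1 : 1 <= r%:R :> R by rewrite ler1n.
  have nr : 0 <= #|vertex (H k)|%:R * r%:R :> R by rewrite mulr_ge0.
  rewrite ltr_distlC /tau; apply/andP; split; last first.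
    rewrite ltr_pdivrMr//; apply: (le_lt_trans T1).
    by rewrite mulrDl ltrDl mulr_gt0.
  rewrite ltr_pdivlMr// mulrBl; move: T2; rewrite -natr1 => T2; lra.
have L_cvg : (t - k.+1%:R^-1) * (tau k / shadow_density R (H k)) ^+ r @[k --> \oo] -->
    t * (x' / x) ^+ r.
  apply: cvgM.
    rewrite -[X in _ --> X]subr0; apply: cvgB; first exact: cvg_cst.
    exact: cvg_harmonic.
  have tau_div : tau k / shadow_density R (H k) @[k --> \oo] --> x' / x.
    by apply: cvgM => //; apply: cvgV => //; rewrite gt_eqF.
  exact: (continuous_cvg _ (@exprn_continuous R r _) tau_div).
(* Half of the gap [x - x'] absorbs the error of the shadow density, the other half the additive [r]
   in the truncation. *)
have c0 : 0 < (x - x') / 2 by rewrite divr_gt0// subr_gt0.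
have [k _ Hk] : \forall k \near \oo,
    [/\ (N <= #|vertex (H k)|)%N, r%:R + #|vertex (H k)|%:R * r%:R < e * M k,
        0 < M k, (T k + r <= #|shadow (H k)|)%N &
        t * (x' / x) ^+ r - e <
          (t - k.+1%:R^-1) * (tau k / shadow_density R (H k)) ^+ r].
  near=> k.
  have Mk : 0 < M k by near: k.
  split => //.
  - near: k; exact: (Hoo _ (nbhs_infty_ge N)).
  - by near: k; exact: linM.
  - have sk : x - (x - x') / 2 < shadow_density R (H k).
      by near: k; apply: (cvgr_gt _ Hx); rewrite ltrBlDr ltrDl.
    have lk : r%:R + #|vertex (H k)|%:R * r%:R < (x - x') / 2 * M k.
      by near: k; exact: linM.
    have /andP[T1 _] := TM k.
    have nr : 0 <= #|vertex (H k)|%:R * r%:R :> R by rewrite mulr_ge0.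
    move: sk; rewrite /shadow_density ltr_pdivlMr// -/(M k) => sk.
    by rewrite -(ler_nat R) natrD; nra.
  - by near: k; apply: (cvgr_gt _ L_cvg); rewrite ltrBlDr ltrDl.
have [Nk ek Mk Tk Lk] := Hk k (leqnn k).
have [H' [subH vH /andP[t1 t2] eH]] := shadow_truncation _ _ _ r0 Tk.
exists H'; split.
- exact: is_free_subgraph subH (freeH k).
- by rewrite vH.
- have /andP[T1 T2] := TM k.
  rewrite /shadow_density vH -/(M k).
  have t1' : (T k)%:R <= #|shadow H'|%:R :> R by rewrite ler_nat.
  have t2' : #|shadow H'|%:R <= (T k)%:R + (r%:R + #|vertex (H k)|%:R * r%:R) :> R.
    by rewrite -natrM -!natrD ler_nat addnA.
  have r1 : 1 <= r%:R :> R by rewrite ler1n.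
  have nr : 0 <= #|vertex (H k)|%:R * r%:R :> R by rewrite mulr_ge0.
  move: T2; rewrite -natr1 => T2.
  rewrite distrC ltr_distlC ltr_pdivrMr// ltr_pdivlMr//; apply/andP; split; lra.
apply: (lt_le_trans Lk).
have s0 : 0 < shadow_density R (H k).
  rewrite /shadow_density divr_gt0// ltr0n.
  by rewrite (leq_trans _ Tk)// addn_gt0 r0 orbT.
apply: (@le_trans _ _ (density R (H k) * (tau k / shadow_density R (H k)) ^+ r)).
  by rewrite ler_wpM2r ?exprn_ge0 ?divr_ge0// ?(ltW s0)// ltW.
(* The normalisation [M k] cancels, leaving the ratio of [T k] to the size of the shadow, as in the
   counting bound [eH]. *)
rewrite /tau /shadow_density -/(M k) invf_div mulrA divfK ?gt_eqF//.
rewrite /density vH mulrAC ler_wpM2r//.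
rewrite expr_div_n mulrA ler_pdivrMr; last first.
  by rewrite exprn_gt0// ltr0n (leq_trans _ Tk)// addn_gt0 r0 orbT.
by rewrite -!natrX -!natrM ler_nat.
Unshelve. all: by end_near. Qed.

(** * Domain, scaling and semicontinuity of the maximal density *)

Lemma proj_feasible_ge0 (R : realType) (r : nat) (F : uhypergraph r -> Prop) (x : R) :
  proj_feasible F x -> 0 <= x.
Proof. by move=> /proj_feasibleP/realizable_above_itv[/andP[]]. Qed.

Lemma feasible_max_ge0 (R : realType) (r : nat) (F : uhypergraph r -> Prop) (x : R) :
  proj_feasible F x -> 0 <= feasible_max F x.
Proof. by move=> Dx; have [_] := feasible_max_spec _ _ _ _ Dx; apply; exact/proj_feasibleP. Qed.

Lemma proj_feasible_down (R : realType) (r : nat) (F : uhypergraph r -> Prop) (x y : R) :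
  (3 <= r)%N -> proj_feasible F y -> 0 <= x <= y -> proj_feasible F x.
Proof.
move=> r3 /[dup] Dy /proj_feasibleP Fy /andP[x0].
rewrite le_eqVlt => /predU1P[->//|xy]; apply/proj_feasibleP.
by rewrite -(mul0r ((x / y) ^+ r)); apply: realizable_above_descent => //; rewrite x0.
Qed.

Lemma feasible_max_scale (R : realType) (r : nat) (F : uhypergraph r -> Prop) (x y : R) :
  (3 <= r)%N -> proj_feasible F y -> 0 < x <= y ->
  feasible_max F y * x ^+ r <= feasible_max F x * y ^+ r.
Proof.
move=> r3 Dy /andP[x0]; rewrite le_eqVlt => /predU1P[->//|xy].
have Dx : proj_feasible F x by apply: proj_feasible_down Dy _; rewrite // !ltW.
have [_ maxx] := feasible_max_spec _ _ _ _ Dx.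
have [Fy _] := feasible_max_spec _ _ _ _ Dy.
rewrite -ler_pdivrMr ?exprn_gt0 ?(lt_trans x0)// -mulrA -expr_div_n; apply: maxx.
by apply: realizable_above_descent Fy; rewrite // ?feasible_max_ge0 ?ltW.
Qed.

(** Maximality at [x] provides a tolerance [d] and a size [N] for which no hypergraph witnesses
    [g x + e]. If [g t] reached this value for some [t] within [d / 2] of [x], a witness for [t]
    with tolerance [d / 2] would be one for [x]. *)
Lemma feasible_max_usc (R : realType) (r : nat) (F : uhypergraph r -> Prop) (x e : R) :
  proj_feasible F x -> 0 < e ->
  \forall t \near x, proj_feasible F t -> feasible_max F t < feasible_max F x + e.
Proof.
move=> Dx e0; have [_ maxx] := feasible_max_spec _ _ _ _ Dx.
have : ~ realizable_above R F x (feasible_max F x + e).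
  by move/maxx; rewrite leNgt ltrDl e0.
move=> /existsNP[d] /existsNP[N] /not_implyP[d0 nH].
have d20 : 0 < d / 2 by rewrite divr_gt0.
near=> t => Dt; rewrite ltNge; apply/negP => gt.
have [Ft _] := feasible_max_spec _ _ _ _ Dt.
have [H [freeH vH sH dH]] := Ft _ N d20.
apply: nH; exists H; split => //; last by lra.
have xt : `|t - x| < d / 2.
  by rewrite distrC; near: t; exact: nbhsx_ballx.
by rewrite (le_lt_trans (ler_distD t _ _))// [ltRHS]splitr ltrD.
Unshelve. all: by end_near. Qed.

Theorem theorem1p11 (R : realType) (r : nat) (hr : (3 <= r)%N)
    (F : uhypergraph r -> Prop) :
  let D : set R := proj_feasible F in
  let g : R -> R := feasible_max F in
  [/\ left_continuous_on D g,
      countable [set x | jump_discontinuity D g x] &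
      {ae (@lebesgue_measure R), forall x, D x -> derivable g x 1}].
Proof.
move=> D g.
have D0 x : D x -> 0 <= x by exact: proj_feasible_ge0.
have Ddown x y : D y -> 0 <= x <= y -> D x by exact: proj_feasible_down.
have gscale x y : D y -> 0 < x <= y -> g y * x ^+ r <= g x * y ^+ r.
  exact: feasible_max_scale.
split.
- by apply: (scaled_left_continuous _ r) => // x e; exact: feasible_max_usc.
- exact: (scaled_countable_jumps _ r).
- exact: (scaled_ae_derivable _ r).
Qed.
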